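(* (i) Let $L_A=I_d-\sum_{i=1}^gA_ix_i$ and $L_B=I_e-\sum_{i=1}^gB_ix_i$ be symmetric pencils, i.e. $A_i\in M_d(\mathbb R)$ and $B_i\in M_e(\mathbb R)$ are symmetric matrices, and let $\mathcal A,\mathcal B$ be the real algebras generated by $A_1,\dots,A_g$ and by $B_1,\dots,B_g$, respectively. Then $\mathscr Z^{\mathrm s}(L_A)\subseteq\mathscr Z^{\mathrm s}(L_B)$ if and only if there exists a $*$-homomorphism of $\mathbb R$-algebras $\mathcal B\to\mathcal A$ induced by $B_i\mapsto A_i$. (ii) Let $L_A=I_d-\sum_{i=1}^gA_ix_i$ and $L_B=I_e-\sum_{i=1}^gB_ix_i$ be hermitian pencils, i.e. $A_i\in M_d(\mathbb C)$ and $B_i\in M_e(\mathbb C)$ are hermitian matrices, and let $\mathcal A,\mathcal B$ be the complex algebras generated by $A_1,\dots,A_g$ and by $B_1,\dots,B_g$, respectively. Then $\mathscr Z^{\mathrm h}(L_A)\subseteq\mathscr Z^{\mathrm h}(L_B)$ if and only if there exists a $*$-homomorphism of $\mathbb C$-algebras $\mathcal B\to\mathcal A$ induced by $B_i\mapsto A_i$.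
   Context: For a pencil $L=I_d-\sum_iA_ix_i$ and $X\in M_n(\mathbb C)^g$ put $L(X)=I_d\otimes I_n-\sum_iA_i\otimes X_i$ (Kronecker product). Let $S_n(\mathbb R)$ be the space of real symmetric and $H_n(\mathbb C)$ the space of complex hermitian $n\times n$ matrices. The free real locus of a symmetric pencil $L$ is $\mathscr Z^{\mathrm s}(L)=\bigcup_n\{X\in S_n(\mathbb R)^g:\det L(X)=0\}$, and that of a hermitian pencil $L$ is $\mathscr Z^{\mathrm h}(L)=\bigcup_n\{X\in H_n(\mathbb C)^g:\det L(X)=0\}$. Generated algebras are possibly non-unital (spanned by nonempty products of generators). The involution $*$ is the transpose in the real case and the conjugate transpose in the complex case. ''Induced by $B_i\mapsto A_i$'' means the homomorphism maps $B_i$ to $A_i$ for all $i$. *)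

(* Defs.v *)
From mathcomp Require Import all_boot all_order all_algebra.
From mathcomp Require Import spectral sesquilinear.
From mathcomp Require Import classical_sets reals.
From mathcomp Require Import complex.
From mathcomp Require mxtens.

Set Implicit Arguments.
Unset Strict Implicit.
Unset Printing Implicit Defensive.

Import Order.TTheory GRing.Theory Num.Theory.
Local Open Scope classical_set_scope.
Local Open Scope ring_scope.

(* A monic pencil [I_d - \sum_i A_i x_i] is represented by its tuple of
   coefficients [A]; [mxtens.tensmx] is the Kronecker product. *)
Definition pencil_eval (F : fieldType) (g d n : nat)
    (A : 'I_g -> 'M[F]_d) (X : 'I_g -> 'M[F]_n) : 'M[F]_(d * n) :=
  mxtens.tensmx 1%:M 1%:M - \sum_(i < g) mxtens.tensmx (A i) (X i).

(* The loci are sets of tuples of matrices of an arbitrary common size: the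
   union over [n] is the dependent sum. *)
Definition free_locus_s (R : realType) (g d : nat) (A : 'I_g -> 'M[R]_d) :
    set {n : nat & 'I_g -> 'M[R]_n} :=
  [set X : {n : nat & 'I_g -> 'M[R]_n} |
    (forall i, projT2 X i \is symmetricmx)
    /\ \det (pencil_eval A (projT2 X)) = 0].

Definition free_locus_h (R : realType) (g d : nat) (A : 'I_g -> 'M[R[i]]_d) :
    set {n : nat & 'I_g -> 'M[R[i]]_n} :=
  [set X : {n : nat & 'I_g -> 'M[R[i]]_n} |
    (forall i, projT2 X i \is hermsymmx)
    /\ \det (pencil_eval A (projT2 X)) = 0].

Definition word_mx (F : fieldType) (g d : nat) (A : 'I_g -> 'M[F]_d)
    (w : seq 'I_g) : 'M[F]_d :=
  \big[mulmx/1%:M]_(i <- w) A i.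

(* Possibly non-unital: the empty word is excluded. *)
Definition gen_alg (F : fieldType) (g d : nat) (A : 'I_g -> 'M[F]_d) :
    set 'M[F]_d :=
  [set M | exists2 s : seq (F * seq 'I_g),
     {in s, forall cw, cw.2 != [::]} &
     M = \sum_(cw <- s) cw.1 *: word_mx A cw.2].

Definition involution_family (F : fieldType) := forall n, 'M[F]_n -> 'M[F]_n.

Definition transpose (R : realType) : involution_family R := fun n M => M^T.

Definition conj_transpose (R : realType) : involution_family R[i] :=
  fun n M => map_mx Num.conj M^T.

(* [phi] is a (not necessarily unital) homomorphism of [F]-algebras with
   involution from [SB] to [SA]; its values outside [SB] are irrelevant. *)
Record star_hom (F : fieldType) (star : involution_family F) (d e : nat)
    (SB : set 'M[F]_e) (SA : set 'M[F]_d) (phi : 'M[F]_e -> 'M[F]_d) : Prop :=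
  StarHom {
    star_hom_into : forall M, SB M -> SA (phi M);
    star_homD : forall M N, SB M -> SB N -> phi (M + N) = phi M + phi N;
    star_homZ : forall (c : F) M, SB M -> phi (c *: M) = c *: phi M;
    star_homM : forall M N, SB M -> SB N -> phi (M *m N) = phi M *m phi N;
    star_hom_star : forall M, SB M -> phi (star e M) = star d (phi M)
  }.

(* Main.v *)
Require Import Defs.
From mathcomp Require Import all_boot all_order all_algebra.
From mathcomp Require Import spectral sesquilinear.
From mathcomp Require Import boolp classical_sets reals.
From mathcomp Require Import complex mxtens.

Set Implicit Arguments.
Unset Strict Implicit.
Unset Printing Implicit Defensive.

Import Order.TTheory GRing.Theory Num.Theory.
Local Open Scope classical_set_scope.
Local Open Scope ring_scope.

(* Write M_A(X) = \sum_i A_i (x) X_i.  A homomorphism B_i |-> A_i exists iff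
   every polynomial relation without constant term between the B_i holds between
   the A_i.  Relations pass to loci: if q = 'X * chi_(M_B(X)) then q(M_B(X)) = 0,
   which is blockwise a family of such relations, so q(M_A(X)) = 0 and an
   eigenvalue 1 of M_A(X) is a root of q.

   Conversely let the hermitian locus of A lie in that of B.  By scaling, for
   hermitian X all nonzero eigenvalues of the (diagonalizable) matrix M_A(X) are
   eigenvalues of M_B(X), so q(M_A(X)) = 0 for the above q.  Along X = H + t K
   this is polynomial in t, so it extends from real t to t = i, that is, to
   arbitrary X, and the inclusion holds for the full free loci.  If f(B) = 0 and
   f(A) <> 0, then h = c f f^* has h(B) = 0 and, for a suitable c, 1 as an
   eigenvalue of h(A).  A companion-like tuple X for h has the property that
   L_A(X) is singular iff h(A) fixes a nonzero vector: a contradiction.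

   The symmetric case reduces to the hermitian one: replacing P + i Q by
   [[P, -Q], [Q, P]] shows that the inclusion of symmetric loci of real pencils
   implies that of their hermitian loci. *)

(** * Eigenvalues of normal matrices and of affine matrix families *)

Lemma poly_nat_roots (F : numDomainType) (p : {poly F}) :
  (forall n : nat, p.[n%:R] = 0) -> p = 0.
Proof.
move=> p0; apply/eqP/negP => /negP pn0.
have := @max_poly_roots _ p [seq n%:R | n <- iota 0 (size p)] pn0.
rewrite size_map size_iota ltnn => H; suff: false by [].
apply: H; first by apply/allP => _ /mapP[n _ ->]; rewrite rootE p0.
by rewrite map_inj_uniq ?iota_uniq //; apply: mulrIn; rewrite oner_neq0.
Qed.

(** The spectral theorem conjugates [P] to a diagonal matrix of eigenvalues, so [p] of it is
    conjugate to a diagonal of values of [p] at eigenvalues. *)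
Lemma normal_horner_eq0 (C : numClosedFieldType) n (P : 'M[C]_n.+1)
    (p : {poly C}) :
  P \is normalmx -> (forall a, eigenvalue P a -> root p a) ->
  horner_mx P p = 0.
Proof.
move=> /orthomx_spectralP; have := spectral_unit P.
move: (spectralmx P) (spectral_diag P) => U D Uu defP Pp.
have hP q : horner_mx P q =
    invmx U *m diag_mx (map_mx (horner q) D) *m U.
  rewrite -horner_mx_diag; elim/poly_ind: q => [|q c IH].
    by rewrite !rmorph0 mulmx0 mul0mx.
  rewrite !rmorphD !rmorphM /= IH !horner_mx_X !horner_mx_C [in LHS]defP.
  rewrite mulmxDr mulmxDl; congr (_ + _).
    by rewrite -!mulmxE !mulmxA mulmxK.
  by rewrite mul_mx_scalar -scalemxAl mulVmx // scalemx1.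
rewrite hP (_ : map_mx _ _ = 0) ?linear0 ?mulmx0 ?mul0mx //.
apply/rowP => i; rewrite !mxE; apply/eqP; apply: Pp.
(* Row [i] of [U] is a left eigenvector for the [i]-th diagonal entry; it is nonzero because [U] is
   invertible. *)
apply/eigenvalueP; exists (row i U).
  rewrite -row_mul {1}defP !mulmxA mulmxV // mul1mx row_mul.
  by rewrite row_diag_mx -scalemxAl -rowE.
apply: contraTneq Uu => Ui0; rewrite -row_free_unit; apply/negP => /row_freeP[W].
move/(congr1 (row i)); rewrite row_mul Ui0 mul0mx => /rowP/(_ i)/eqP.
by rewrite !mxE eqxx eq_sym oner_eq0.
Qed.

(** Evaluating 'X times the characteristic polynomial of Q0 + t Q1 at P0 + t P1 gives a matrix
    polynomial in t. It vanishes at all natural t, hence identically. The factor 'X absorbs the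
    eigenvalue 0, which the hypothesis does not cover. *)
Lemma eigenvalue_transfer (C : numClosedFieldType) N K
    (P0 P1 : 'M[C]_N) (Q0 Q1 : 'M[C]_K) :
  (forall t : nat, P0 + t%:R *: P1 \is normalmx) ->
  (forall (t : nat) a, a != 0 ->
    eigenvalue (P0 + t%:R *: P1) a -> eigenvalue (Q0 + t%:R *: Q1) a) ->
  forall z a, a != 0 ->
    eigenvalue (P0 + z *: P1) a -> eigenvalue (Q0 + z *: Q1) a.
Proof.
case: N P0 P1 => [|N] P0 P1 Pn PQ z a a0.
  by case/eigenvalueP=> u _; rewrite thinmx0 eqxx.
pose lin M (M0 M1 : 'M[C]_M) : 'M[{poly C}]_M :=
  map_mx polyC M0 + 'X *: map_mx polyC M1.
have linE M (M0 M1 : 'M[C]_M) t :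
    map_mx (horner_eval t) (lin M M0 M1) = M0 + t *: M1.
  apply/matrixP => i j; rewrite !mxE /horner_eval !hornerE.
  by rewrite mulrC.
pose F := horner_mx (lin _ P0 P1) ('X * char_poly (lin _ Q0 Q1)).
have FE t : map_mx (horner_eval t) F =
    horner_mx (P0 + t *: P1) ('X * char_poly (Q0 + t *: Q1)).
  by rewrite map_horner_mx rmorphM /= map_polyX map_char_poly !linE.
have F0 : F = 0.
  apply/matrixP => i j; rewrite [RHS]mxE; apply: poly_nat_roots => t.
  have /matrixP/(_ i j) : map_mx (horner_eval t%:R) F = 0.
    rewrite FE; apply: normal_horner_eq0 (Pn t) _ => b bP.
    rewrite rootM rootX; case: eqP => //= /eqP b0.
    by rewrite -eigenvalue_root_char PQ.
  by rewrite !mxE.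
case/eigenvalueP=> u uP u0.
(* An eigenvector for [a] is one of any polynomial [q] in the matrix, for [q.[a]]; since [F] is
   zero, [a] is then a root. *)
have hu q : u *m horner_mx (P0 + z *: P1) q = q.[a] *: u.
  elim/poly_ind: q => [|q c IH]; first by rewrite rmorph0 horner0 mulmx0 scale0r.
  rewrite rmorphD rmorphM /= horner_mx_X horner_mx_C mulmxDr mulmxA IH.
  by rewrite -scalemxAl uP scalerA mul_mx_scalar -scalerDl !hornerE.
have := hu ('X * char_poly (Q0 + z *: Q1)); rewrite -FE F0 map_mx0 mulmx0.
move/esym/eqP; rewrite scaler_eq0 (negPf u0) orbF hornerM hornerX mulf_eq0.
by rewrite (negPf a0) eigenvalue_root_char.
Qed.

(** * Singular pencils as matrix equations *)

Definition kron_sum (F : fieldType) (g d n : nat) (A : 'I_g -> 'M[F]_d)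
    (X : 'I_g -> 'M[F]_n) : 'M[F]_(d * n) :=
  \sum_(i < g) tensmx (A i) (X i).

Lemma pencil_evalE (F : fieldType) g d n (A : 'I_g -> 'M[F]_d)
    (X : 'I_g -> 'M[F]_n) :
  pencil_eval A X = 1%:M - kron_sum A X.
Proof.
congr (_ - _); apply/matrixP => a b.
case: (mxtens_indexP a) => i j; case: (mxtens_indexP b) => k l.
rewrite tensmxE !mxE -natrM mulnb (can_eq (@mxtens_indexK _ _)).
by rewrite xpair_eqE.
Qed.

Lemma det_pencil_eq0 (F : fieldType) g d n (A : 'I_g -> 'M[F]_d)
    (X : 'I_g -> 'M[F]_n) :
  \det (pencil_eval A X) = 0 <-> eigenvalue (kron_sum A X) 1.
Proof.
rewrite pencil_evalE; split.
  move/eqP/det0P=> [u u0 uE]; apply/eigenvalueP; exists u => //.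
  by apply/esym/eqP; rewrite scale1r -subr_eq0 -{1}[u]mulmx1 -mulmxBr uE.
case/eigenvalueP=> u uE u0; apply/eqP/det0P; exists u => //.
by rewrite mulmxBr uE mulmx1 scale1r subrr.
Qed.

Lemma eigenvalue_kron_sum (F : fieldType) g d n (A : 'I_g -> 'M[F]_d)
    (X : 'I_g -> 'M[F]_n) a :
  eigenvalue (kron_sum A X) a <->
  exists2 V : 'M[F]_(d, n), V != 0 & \sum_i (A i)^T *m V *m X i = a *: V.
Proof.
(* Reshaping rows of length d n into d by n matrices turns right multiplication by a Kronecker
   product into V |-> A^T V X. *)
pose vec (u : 'rV[F]_(d * n)) := \matrix_(i < d, j < n) u 0 (mxtens_index (i, j)).
have vecM u : vec (u *m kron_sum A X) = \sum_i (A i)^T *m vec u *m X i.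
  apply/matrixP => j k; rewrite summxE !mxE /kron_sum.
  transitivity (\sum_i \sum_b u 0 b * tensmx (A i) (X i) b (mxtens_index (j, k))).
    rewrite exchange_big; apply: eq_bigr => b _.
    by rewrite summxE mulr_sumr.
  apply: eq_bigr => i _; rewrite !mxE.
  rewrite (reindex (@mxtens_index d n)) /=; last first.
    by exists (@mxtens_unindex d n) => p _; [exact: mxtens_indexK|exact: mxtens_unindexK].
  transitivity (\sum_p \sum_q u 0 (mxtens_index (p, q)) *
      tensmx (A i) (X i) (mxtens_index (p, q)) (mxtens_index (j, k))).
    by rewrite pair_bigA; apply: eq_bigr => -[].
  rewrite exchange_big; apply: eq_bigr => q _; rewrite !mxE mulr_suml.
  by apply: eq_bigr => p _; rewrite tensmxE !mxE mulrA [_ * u _ _]mulrC.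
have vecZ c u : vec (c *: u) = c *: vec u by apply/matrixP => i j; rewrite !mxE.
have vec_inj u v : vec u = vec v -> u = v.
  move=> uv; apply/rowP => p; case: (mxtens_indexP p) => j k.
  by have /matrixP/(_ j k) := uv; rewrite !mxE.
split=> [/eigenvalueP[u uE u0]|[V V0 VE]].
  exists (vec u); last by rewrite -vecM uE vecZ.
  apply: contra_neq u0 => u0; apply: vec_inj; rewrite u0.
  by apply/matrixP => i j; rewrite !mxE.
pose u : 'rV[F]_(d * n) :=
  \row_p V (mxtens_unindex p).1 (mxtens_unindex p).2.
have uV : vec u = V by apply/matrixP => i j; rewrite !mxE mxtens_indexK.
apply/eigenvalueP; exists u; first by apply: vec_inj; rewrite vecM vecZ uV.
by apply: contra_neq V0 => u0; rewrite -uV u0; apply/matrixP => i j; rewrite !mxE.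
Qed.

(** Transposing the pencil keeps its determinant and moves the transposition from the coefficients
    to [X], so that words in [A] itself can act on the columns of [V]. *)
Lemma pencil_singularP (F : fieldType) g d n (A : 'I_g -> 'M[F]_d)
    (X : 'I_g -> 'M[F]_n) :
  \det (pencil_eval A X) = 0 <->
  exists2 V : 'M[F]_(d, n), V != 0 & \sum_i A i *m V *m (X i)^T = V.
Proof.
rewrite -det_tr (_ : _^T = pencil_eval (fun i => (A i)^T) (fun i => (X i)^T)).
  rewrite det_pencil_eq0 eigenvalue_kron_sum.
  have E (V : 'M[F]_(d, n)) : \sum_i A i *m V *m (X i)^T =
      \sum_i (A i)^T^T *m V *m (X i)^T.
    by apply: eq_bigr => i _; rewrite trmxK.
  by split=> -[V V0 VE]; exists V => //; move: VE; rewrite E scale1r.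
rewrite !pencil_evalE linearB /= trmx1; congr (_ - _).
by rewrite linear_sum; apply: eq_bigr => i _; rewrite /= trmx_tens.
Qed.

Lemma kron_sumD (F : fieldType) g d n (A : 'I_g -> 'M[F]_d)
    (X Y : 'I_g -> 'M[F]_n) z :
  kron_sum A (fun i => X i + z *: Y i) = kron_sum A X + z *: kron_sum A Y.
Proof.
rewrite /kron_sum scaler_sumr -big_split; apply: eq_bigr => i _ /=.
by apply/matrixP => a b; rewrite !mxE mulrDr mulrCA.
Qed.

(** * Hermitian matrices; from hermitian loci to full free loci *)

Definition adjmx (C : numClosedFieldType) m n (M : 'M[C]_(m, n)) : 'M[C]_(n, m) :=
  map_mx Num.conj M^T.

Lemma adjmxK (C : numClosedFieldType) m n (M : 'M[C]_(m, n)) :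
  adjmx (adjmx M) = M.
Proof. by apply/matrixP => i j; rewrite !mxE conjCK. Qed.

Lemma adjmxM (C : numClosedFieldType) m n p (M : 'M[C]_(m, n)) (N : 'M[C]_(n, p)) :
  adjmx (M *m N) = adjmx N *m adjmx M.
Proof. by rewrite /adjmx trmx_mul map_mxM. Qed.

Lemma adjmxZ (C : numClosedFieldType) m n a (M : 'M[C]_(m, n)) :
  adjmx (a *: M) = a^* *: adjmx M.
Proof. by rewrite /adjmx linearZ /= map_mxZ. Qed.

Lemma adjmx1 (C : numClosedFieldType) n : adjmx (1%:M : 'M[C]_n) = 1%:M.
Proof. by rewrite /adjmx trmx1 map_mx1. Qed.

Lemma adjmx_sum (C : numClosedFieldType) m n (I : Type) (r : seq I)
    (M : I -> 'M[C]_(m, n)) :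
  adjmx (\sum_(i <- r) M i) = \sum_(i <- r) adjmx (M i).
Proof. by rewrite /adjmx !raddf_sum. Qed.

Lemma hermsymmxP (C : numClosedFieldType) n (M : 'M[C]_n) :
  M \is hermsymmx <-> adjmx M = M.
Proof.
by rewrite qualifE /= expr0 scale1r; split=> [/eqP/esym|/esym/eqP].
Qed.

Lemma mulmx_adj_eq0 (C : numClosedFieldType) m n (N : 'M[C]_(m, n)) :
  N *m adjmx N = 0 -> N = 0.
Proof.
move=> /matrixP N0; apply/matrixP => i j; have /eqP := N0 i i.
rewrite !mxE; under eq_bigr do rewrite !mxE -normCK.
rewrite psumr_eq0 => [|k _]; last by rewrite exprn_ge0.
by move/allP/(_ j); rewrite mem_index_enum sqrf_eq0 normr_eq0 => /(_ isT)/eqP.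
Qed.

Lemma hermitian_eigenvalue_real (C : numClosedFieldType) n (M : 'M[C]_n) a :
  M \is hermsymmx -> eigenvalue M a -> a^* = a.
Proof.
move=> /hermsymmxP Mh /eigenvalueP[u uM u0].
(* The scalar u M u^* equals its own conjugate, and u u^* is nonzero. *)
have E : u *m M *m adjmx u = a *: (u *m adjmx u) by rewrite uM -scalemxAl.
have := congr1 (@adjmx _ _ _) E; rewrite adjmxZ !adjmxM adjmxK Mh mulmxA E.
move/eqP; rewrite -subr_eq0 -scalerBl scaler_eq0 subr_eq0 => /orP[/eqP/esym//|].
by move/eqP/mulmx_adj_eq0 => u_eq0; rewrite u_eq0 eqxx in u0.
Qed.

Lemma kron_sum_hermitian (C : numClosedFieldType) g d n (A : 'I_g -> 'M[C]_d)
    (X : 'I_g -> 'M[C]_n) :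
  (forall i, A i \is hermsymmx) -> (forall i, X i \is hermsymmx) ->
  kron_sum A X \is hermsymmx.
Proof.
move=> Ah Xh; apply/hermsymmxP; rewrite adjmx_sum; apply: eq_bigr => i _.
rewrite /adjmx trmx_tens map_mxT -!/(adjmx _).
by have /hermsymmxP -> := Ah i; have /hermsymmxP -> := Xh i.
Qed.

Definition herm_locus_sub (C : numClosedFieldType) g d e
    (A : 'I_g -> 'M[C]_d) (B : 'I_g -> 'M[C]_e) :=
  forall n (X : 'I_g -> 'M[C]_n), (forall i, X i \is hermsymmx) ->
    \det (pencil_eval A X) = 0 -> \det (pencil_eval B X) = 0.

Lemma herm_locus_sub_full (C : numClosedFieldType) g d e
    (A : 'I_g -> 'M[C]_d) (B : 'I_g -> 'M[C]_e) :
  (forall i, A i \is hermsymmx) -> herm_locus_sub A B ->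
  forall n (X : 'I_g -> 'M[C]_n),
    \det (pencil_eval A X) = 0 -> \det (pencil_eval B X) = 0.
Proof.
move=> Ah AB n X /det_pencil_eq0 AX; apply/det_pencil_eq0.
(* Cartesian decomposition X = H + i K with hermitian parts; the factor in [K] is 1 / (2i). *)
pose H i := 2^-1 *: (X i + adjmx (X i)).
pose K i := (- ('i / 2)) *: (X i - adjmx (X i)).
have two0 : (2 : C) != 0 by rewrite pnatr_eq0.
have XE i : X i = H i + 'i *: K i.
  apply/matrixP => a b; rewrite !mxE; set x := X i a b; set y := _^*.
  rewrite mulrA mulrN mulrA -expr2 sqrCi mulN1r opprK -mulrDr.
  rewrite addrACA subrr addr0. by rewrite -mulr2n -(mulr_natl x) mulKf.
have HKh (t : nat) i : H i + t%:R *: K i \is hermsymmx.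
  apply/hermsymmxP/matrixP => a b; rewrite !mxE.
  rewrite !(rmorph_nat, fmorphV, rmorphM, rmorphN, rmorphD) /= !conjCK conjCi.
  congr (_ * _ + _ * _); first exact: addrC.
  by rewrite !mulNr opprK -mulrN opprB.
have kE z M (D : 'I_g -> 'M[C]_M) :
    kron_sum D (fun i => H i + z *: K i) = kron_sum D H + z *: kron_sum D K.
  exact: kron_sumD.
have XkE M (D : 'I_g -> 'M[C]_M) :
    kron_sum D X = kron_sum D H + 'i *: kron_sum D K.
  by rewrite -kE; apply: eq_bigr => i _; rewrite -XE.
rewrite XkE; apply: (@eigenvalue_transfer _ _ _ (kron_sum A H) (kron_sum A K));
  rewrite ?oner_eq0 -?XkE // => t.
  by rewrite -kE; apply/hermitian_normalmx/kron_sum_hermitian.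
move=> a a0; rewrite -!kE => aA.
have a_real : a^* = a.
  exact: hermitian_eigenvalue_real (kron_sum_hermitian Ah (HKh t)) aA.
(* The hypothesis on loci concerns the eigenvalue 1 only. Dividing the tuple by [a] reduces to it,
   and the tuple stays hermitian because [a] is real. *)
have scaleE M (D : 'I_g -> 'M[C]_M) (Y : 'I_g -> 'M[C]_n) :
    eigenvalue (kron_sum D Y) a <-> eigenvalue (kron_sum D (fun i => a^-1 *: Y i)) 1.
  have -> : kron_sum D (fun i => a^-1 *: Y i) = a^-1 *: kron_sum D Y.
    rewrite /kron_sum scaler_sumr; apply: eq_bigr => i _.
    by apply/matrixP => p q; rewrite !mxE mulrCA.
  split=> /eigenvalueP[u uE u0]; apply/eigenvalueP; exists u => //.
    by rewrite -scalemxAr uE scalerA mulVf.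
  by rewrite -[LHS]scale1r -(divff a0) -scalerA scalemxAr uE scale1r.
have [_] := scaleE _ B (fun i => H i + t%:R *: K i); apply.
have [+ _] := scaleE _ A (fun i => H i + t%:R *: K i) => /(_ aA) aA1.
have [+ _] := det_pencil_eq0 B (fun i => a^-1 *: (H i + t%:R *: K i)); apply.
apply: AB => [i|]; last by apply/det_pencil_eq0.
have /hermsymmxP E := HKh t i; apply/hermsymmxP.
by rewrite adjmxZ E fmorphV /= a_real.
Qed.

(** * Linearization of noncommutative polynomials without constant term *)

Definition eval_words (F : fieldType) (g d : nat) (A : 'I_g -> 'M[F]_d)
    (s : seq (F * seq 'I_g)) : 'M[F]_d :=
  \sum_(cw <- s) cw.1 *: word_mx A cw.2.

Lemma word_mx_cons (F : fieldType) g d (A : 'I_g -> 'M[F]_d) i w :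
  word_mx A (i :: w) = A i *m word_mx A w.
Proof. by rewrite /word_mx big_cons. Qed.

Lemma word_mx_nil (F : fieldType) g d (A : 'I_g -> 'M[F]_d) :
  word_mx A [::] = 1%:M.
Proof. by rewrite /word_mx big_nil. Qed.

(* The words of the suffix closure index the rows and columns of the linearization. *)
Lemma suffix_closed_words (F : fieldType) (I : eqType) (s : seq (F * seq I)) :
  exists W : seq (seq I), [/\ uniq W, [::] \in W,
    forall i w, i :: w \in W -> w \in W &
    forall c i w, (c, i :: w) \in s -> w \in W].
Proof.
pose suffs (w : seq I) := [seq drop k w | k <- iota 0 (size w).+1].
have suffsP w x : reflect (suffix x w) (x \in suffs w).
  apply: (iffP mapP) => [[k _ ->]|/suffixP[y ->]]; first exact: suffix_drop.
  exists (size y); first by rewrite mem_iota /= ltnS size_cat leq_addr.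
  by rewrite drop_size_cat.
exists (undup ([::] :: flatten [seq suffs cw.2 | cw <- s])).
split=> [||i w|c i w iw]; first exact: undup_uniq.
- by rewrite mem_undup mem_head.
- rewrite !mem_undup !inE /= => /flattenP[_ /mapP[cw cws ->] /suffsP/suffixP[y yE]].
  apply/orP; right; apply/flattenP; exists (suffs cw.2); first exact: map_f.
  by apply/suffsP/suffixP; exists (rcons y i); rewrite cat_rcons.
rewrite mem_undup inE; apply/orP; right; apply/flattenP.
exists (suffs (i :: w)); first by apply/mapP; exists (c, i :: w).
by apply/suffsP/suffixP; exists [:: i].
Qed.

(** The tuple [X] depends on [s] alone and serves coefficient tuples of every size, so one [X] can
    be tested in the loci of both pencils. *)
Lemma linearization (F : fieldType) g (s : seq (F * seq 'I_g)) :
  {in s, forall cw, cw.2 != [::]} ->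
  exists n (X : 'I_g -> 'M[F]_n), forall d (A : 'I_g -> 'M[F]_d),
    (exists2 V : 'M[F]_(d, n), V != 0 & \sum_i A i *m V *m X i = V) <->
    (exists2 u : 'cV[F]_d, u != 0 & eval_words A s *m u = u).
Proof.
move=> s_n0; have [W [Wu W0 Wcl sW]] := suffix_closed_words s.
pose x i (w t : seq 'I_g) : F := if t == [::]
  then \sum_(cw <- s | cw.2 == i :: w) cw.1 else (t == i :: w)%:R.
(* With columns v_w, w in W, the equation V = \sum_i A_i V X_i reads
   v_(i w) = A_i v_w and v_[] = \sum_(c w in s) c A^w v_[]. *)
pose S (j : 'I_(size W)) := nth [::] W j.
exists (size W), (fun i => \matrix_(j, k) x i (S j) (S k)) => d A.
(* [G v y] is A_i v_w when y = i w with w in [W], and 0 otherwise; the double sum matches the shape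
   of the columns of \sum_i A_i V X_i. *)
pose G (v : seq 'I_g -> 'cV[F]_d) y :=
  \sum_i A i *m \sum_(w <- W) (y == i :: w)%:R *: v w.
have GE v i w : w \in W -> G v (i :: w) = A i *m v w.
  move=> wW; rewrite /G (bigD1 i) //= [X in _ + X]big1 ?addr0 => [|k ki].
    rewrite (bigD1_seq w) //= eqxx scale1r big1 ?addr0 // => z zw.
    by rewrite eqseq_cons eqxx eq_sym (negPf zw) scale0r.
  rewrite big1 ?mulmx0 // => z _.
  by rewrite eqseq_cons eq_sym (negPf ki) scale0r.
have GW v i w : (forall i w, i :: w \in W -> v (i :: w) = A i *m v w) ->
    w \in W -> G v (i :: w) = word_mx A (i :: w) *m v [::].
  move=> vA wW; rewrite GE // word_mx_cons -mulmxA; congr (_ *m _).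
  elim: w wW => [|k w IH] wW; first by rewrite word_mx_nil mul1mx.
  by rewrite vA // (IH (Wcl _ _ wW)) word_mx_cons mulmxA.
have colE (V : 'M[F]_(d, size W)) v k : (forall j, col j V = v (S j)) ->
  col k (\sum_i A i *m V *m \matrix_(j, k) x i (S j) (S k)) =
  if S k == [::] then \sum_(cw <- s) cw.1 *: G v cw.2 else G v (S k).
  move=> Vv; transitivity (\sum_i A i *m \sum_(w <- W) x i w (S k) *: v w).
    rewrite linear_sum; apply: eq_bigr => i _; rewrite -mulmxA.
    apply/colP => a; rewrite !mxE; apply: eq_bigr => b _; congr (_ * _).
    rewrite !mxE summxE (big_nth [::]) big_mkord; apply: eq_bigr => j _.
    by rewrite -/(S j) -Vv !mxE mulrC.
  rewrite /x; case: eqP => // _.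
  under [RHS]eq_bigr do rewrite scaler_sumr.
  rewrite [RHS]exchange_big; apply: eq_bigr => i _ /=.
  under [RHS]eq_bigr do rewrite scalemxAr.
  rewrite -mulmx_sumr; congr (_ *m _).
  under [RHS]eq_bigr do rewrite scaler_sumr.
  rewrite [RHS]exchange_big; apply: eq_bigr => w _ /=.
  rewrite scaler_suml big_mkcond; apply: eq_bigr => cw _.
  by case: eqP; rewrite ?scale1r ?scale0r ?scaler0.
have evE v : (forall i w, i :: w \in W -> v (i :: w) = A i *m v w) ->
    \sum_(cw <- s) cw.1 *: G v cw.2 = eval_words A s *m v [::].
  move=> vA; rewrite /eval_words mulmx_suml; apply: eq_big_seq => -[c [|i w]] cws.
    by have := s_n0 _ cws.
  by rewrite /= (GW _ _ _ vA (sW _ _ _ cws)) scalemxAl.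
have SK w : w \in W -> exists j, S j = w.
  move=> wW; have jlt : (index w W < size W)%N by rewrite index_mem.
  by exists (Ordinal jlt); rewrite /S nth_index.
have SW j : S j \in W by apply: mem_nth.
split=> [[V V0 VE]|[u u0 uE]].
  (* Columns of [V] indexed by words; outside [W] the index is out of range and the value is 0. *)
  pose v w := if insub (index w W) is Some j then col j V else 0.
  have Vv j : col j V = v (S j).
    by rewrite /v index_uniq // valK.
  have vA i w : i :: w \in W -> v (i :: w) = A i *m v w.
    move=> iw; have [k kE] := SK _ iw.
    by rewrite -kE -Vv -VE (colE _ v) // kE /= (GE _ _ _ (Wcl _ _ iw)).
  have v0E : eval_words A s *m v [::] = v [::].
    have [k kE] := SK _ W0.
    by rewrite -[in RHS]kE -Vv -[in RHS]VE (colE _ v) // kE /= evE.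
  exists (v [::]) => //; apply: contra_neq V0 => v0.
  apply/matrixP => a j; have /colP/(_ a) := Vv j; rewrite !mxE => ->.
  suff -> : v (S j) = 0 by rewrite mxE.
  (* As [W] is suffix closed, every column is a word in [A] applied to v_[], so v_[] = 0 would force
     V = 0. *)
  have : S j \in W by []; elim: (S j) => // i w IH iw.
  by rewrite vA // (IH (Wcl _ _ iw)) mulmx0.
pose v w := word_mx A w *m u.
have v0 : v [::] = u by rewrite /v word_mx_nil mul1mx.
have vA i w : i :: w \in W -> v (i :: w) = A i *m v w.
  by rewrite /v word_mx_cons mulmxA.
pose V := \matrix_(a, j) v (S j) a 0.
have Vv j : col j V = v (S j) by apply/colP => a; rewrite !mxE.
exists V.
  apply: contra_neq u0 => V0; have [k kE] := SK _ W0.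
  by rewrite -v0 -kE -Vv V0 col0.
apply/matrixP => a k; have /colP/(_ a) := colE V v k Vv; rewrite mxE => ->.
rewrite mxE; case: eqP => [->|]; first by rewrite evE // v0 uE.
have := SW k; case: (S k) => // i w iw _.
by rewrite vA // (GE _ _ _ (Wcl _ _ iw)).
Qed.

(** * Star-homomorphisms as inclusions of polynomial relations *)

Lemma word_mx_cat (F : fieldType) g d (A : 'I_g -> 'M[F]_d) v w :
  word_mx A (v ++ w) = word_mx A v *m word_mx A w.
Proof.
elim: v => [|i v IH]; first by rewrite word_mx_nil mul1mx.
by rewrite /= !word_mx_cons IH mulmxA.
Qed.

(* The graph of the candidate homomorphism [B_i |-> A_i]. *)
Definition hom_graph (F : fieldType) g d e (A : 'I_g -> 'M[F]_d)
    (B : 'I_g -> 'M[F]_e) (M : 'M[F]_e) (N : 'M[F]_d) : Prop :=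
  exists2 s : seq (F * seq 'I_g), {in s, forall cw, cw.2 != [::]} &
    M = eval_words B s /\ N = eval_words A s.

Definition relations_sub (F : fieldType) g d e (A : 'I_g -> 'M[F]_d)
    (B : 'I_g -> 'M[F]_e) : Prop :=
  forall N, hom_graph A B 0 N -> N = 0.

Lemma hom_graph0 (F : fieldType) g d e (A : 'I_g -> 'M[F]_d)
    (B : 'I_g -> 'M[F]_e) :
  hom_graph A B 0 0.
Proof. by exists [::] => //; rewrite /eval_words !big_nil. Qed.

Lemma hom_graph_gen (F : fieldType) g d e (A : 'I_g -> 'M[F]_d)
    (B : 'I_g -> 'M[F]_e) i :
  hom_graph A B (B i) (A i).
Proof.
exists [:: (1, [:: i])] => [cw|]; first by rewrite inE => /eqP ->.
by rewrite /eval_words !big_seq1 !word_mx_cons !word_mx_nil !mulmx1 !scale1r.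
Qed.

Lemma hom_graphD (F : fieldType) g d e (A : 'I_g -> 'M[F]_d)
    (B : 'I_g -> 'M[F]_e) M N M' N' :
  hom_graph A B M N -> hom_graph A B M' N' -> hom_graph A B (M + M') (N + N').
Proof.
move=> [s s0 [-> ->]] [t t0 [-> ->]]; exists (s ++ t) => [cw|].
  by rewrite mem_cat => /orP[/s0|/t0].
by rewrite /eval_words !big_cat.
Qed.

Lemma hom_graphZ (F : fieldType) g d e (A : 'I_g -> 'M[F]_d)
    (B : 'I_g -> 'M[F]_e) c M N :
  hom_graph A B M N -> hom_graph A B (c *: M) (c *: N).
Proof.
move=> [s s0 [-> ->]]; exists [seq (c * cw.1, cw.2) | cw <- s].
  by move=> _ /mapP[cw /s0 cw0 ->].
rewrite /eval_words !big_map !scaler_sumr.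
by split; apply: eq_bigr => cw _; rewrite scalerA.
Qed.

Lemma hom_graphM (F : fieldType) g d e (A : 'I_g -> 'M[F]_d)
    (B : 'I_g -> 'M[F]_e) M N M' N' :
  hom_graph A B M N -> hom_graph A B M' N' -> hom_graph A B (M *m M') (N *m N').
Proof.
move=> [s s0 [-> ->]] [t t0 [-> ->]].
exists [seq (x.1 * y.1, x.2 ++ y.2) | x <- s, y <- t].
  by move=> _ /allpairsP[[x y] [/s0 x0 _ ->]] /=; case: x.2 x0.
have E n (D : 'I_g -> 'M[F]_n) : eval_words D s *m eval_words D t =
    eval_words D [seq (x.1 * y.1, x.2 ++ y.2) | x <- s, y <- t].
  rewrite /eval_words big_allpairs_dep mulmx_suml; apply: eq_bigr => x _.
  rewrite mulmx_sumr; apply: eq_bigr => y _ /=.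
  by rewrite word_mx_cat -scalemxAl -scalemxAr scalerA.
by rewrite !E.
Qed.

Lemma hom_graph_sum (F : fieldType) g d e (A : 'I_g -> 'M[F]_d)
    (B : 'I_g -> 'M[F]_e) (I : Type) (r : seq I) M N :
  (forall i, hom_graph A B (M i) (N i)) ->
  hom_graph A B (\sum_(i <- r) M i) (\sum_(i <- r) N i).
Proof.
move=> MN; elim/big_ind2: _ => [|*|//]; [exact: hom_graph0|exact: hom_graphD].
Qed.

(** The graph is a linear subspace, so it is single-valued as soon as only 0 lies over 0. *)
Lemma hom_graph_fun (F : fieldType) g d e (A : 'I_g -> 'M[F]_d)
    (B : 'I_g -> 'M[F]_e) M N N' :
  relations_sub A B -> hom_graph A B M N -> hom_graph A B M N' -> N = N'.
Proof.
move=> AB MN /(hom_graphZ (-1)) /(hom_graphD MN); rewrite !scaleN1r subrr.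
by move/AB/eqP; rewrite subr_eq0 => /eqP.
Qed.

Lemma gen_algE (F : fieldType) g d e (A : 'I_g -> 'M[F]_d)
    (B : 'I_g -> 'M[F]_e) M :
  gen_alg B M <-> exists N, hom_graph A B M N.
Proof.
split=> [[s s0 E]|[N [s s0 [E _]]]]; last by exists s.
by exists (eval_words A s), s.
Qed.

Lemma gen_alg_graph (F : fieldType) g d e (A : 'I_g -> 'M[F]_d)
    (B : 'I_g -> 'M[F]_e) M N :
  hom_graph A B M N -> gen_alg A N.
Proof. by case=> s s0 [_ E]; exists s. Qed.

(** The parameter [conj] treats the transpose (identity on scalars) and the conjugate transpose
    uniformly. *)
Record semilinear_involution (F : fieldType) (conj : F -> F)
    (star : involution_family F) : Prop := SemilinearInvolution {
  starD : forall n (M N : 'M[F]_n), star n (M + N) = star n M + star n N;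
  starZ : forall n c (M : 'M[F]_n), star n (c *: M) = conj c *: star n M;
  starM : forall n (M N : 'M[F]_n), star n (M *m N) = star n N *m star n M;
  star1 : forall n, star n 1%:M = 1%:M
}.

(** On self-adjoint generators the involution conjugates coefficients and reverses words, by the
    same rule for [A] and [B]. *)
Lemma hom_graph_star (F : fieldType) conj (star : involution_family F) g d e
    (A : 'I_g -> 'M[F]_d) (B : 'I_g -> 'M[F]_e) M N :
  semilinear_involution conj star ->
  (forall i, star d (A i) = A i) -> (forall i, star e (B i) = B i) ->
  hom_graph A B M N -> hom_graph A B (star e M) (star d N).
Proof.
move=> S Asa Bsa [s s0 [-> ->]].
exists [seq (conj cw.1, rev cw.2) | cw <- s].
  by move=> _ /mapP[cw /s0 cw0 ->]; rewrite -size_eq0 size_rev size_eq0.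
have star0 n : star n 0 = 0.
  by apply: (@addrI _ (star n 0)); rewrite -(starD S) !addr0.
have E n (D : 'I_g -> 'M[F]_n) : (forall i, star n (D i) = D i) ->
    star n (eval_words D s) = eval_words D [seq (conj cw.1, rev cw.2) | cw <- s].
  move=> Dsa; rewrite /eval_words big_map.
  rewrite (big_morph _ (starD S (n := n)) (star0 n)); apply: eq_bigr => -[c w] _ /=.
  rewrite (starZ S); congr (_ *: _); elim: w => [|i w IH].
    by rewrite word_mx_nil (star1 S).
  by rewrite word_mx_cons (starM S) IH Dsa rev_cons -cats1 word_mx_cat
    word_mx_cons word_mx_nil mulmx1.
by rewrite !E.
Qed.

Lemma star_hom_exists (F : fieldType) conj (star : involution_family F) g d e
    (A : 'I_g -> 'M[F]_d) (B : 'I_g -> 'M[F]_e) :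
  semilinear_involution conj star ->
  (forall i, star d (A i) = A i) -> (forall i, star e (B i) = B i) ->
  (relations_sub A B <-> exists phi : 'M[F]_e -> 'M[F]_d,
    star_hom star (gen_alg B) (gen_alg A) phi /\ forall i, phi (B i) = A i).
Proof.
move=> S Asa Bsa; split=> [AB|[phi [[_ phiD phiZ phiM _] phiB]] N [s s0 [Bs ->]]].
  (* Outside [gen_alg B] the implication is vacuous and the chosen value unconstrained; 0 only
     witnesses existence. *)
  have /choice[phi phiP] M : exists N, gen_alg B M -> hom_graph A B M N.
    case: (pselect (gen_alg B M)) => [/(gen_algE A)[N MN]|nM]; last by exists 0.
    by exists N.
  have phiE M N : hom_graph A B M N -> phi M = N.
    move=> MN; apply: (hom_graph_fun AB _ MN); apply: phiP.
    by apply: (gen_algE A B M).2; exists N.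
  exists phi; split; last by move=> i; apply/phiE/hom_graph_gen.
  split=> [M /phiP/gen_alg_graph //|M N /phiP MM /phiP NN|c M /phiP MM
    |M N /phiP MM /phiP NN|M /phiP MM]; apply: phiE.
  - exact: hom_graphD.
  - exact: hom_graphZ.
  - exact: hom_graphM.
  - exact: (hom_graph_star S Asa Bsa MM).
have genB i : gen_alg B (B i).
  by apply: (gen_algE B B _).2; exists (B i); apply: hom_graph_gen.
have genw c i w : gen_alg B (c *: word_mx B (i :: w)).
  by exists [:: (c, i :: w)]; [move=> cw; rewrite inE => /eqP ->|rewrite big_seq1].
have genw1 i w : gen_alg B (word_mx B (i :: w)) by rewrite -[word_mx _ _]scale1r.
(* The induction starts at single letters, since [phi] need not preserve the identity matrix. *)
have phiw i w : phi (word_mx B (i :: w)) = word_mx A (i :: w).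
  elim: w i => [|j w IH] i.
    by rewrite !word_mx_cons !word_mx_nil !mulmx1 phiB.
  by rewrite word_mx_cons phiM // IH phiB [in RHS]word_mx_cons.
have phi0 : phi 0 = 0.
  rewrite -[X in phi X](scale0r 0) phiZ ?scale0r //.
  by apply: (gen_algE B B _).2; exists 0; apply: hom_graph0.
have phiE t : {in t, forall cw, cw.2 != [::]} ->
    phi (eval_words B t) = eval_words A t.
  elim: t => [|[c [|i w]] t IH] t0; first by rewrite /eval_words !big_nil.
    by have := t0 _ (mem_head _ _).
  have t0' : {in t, forall cw, cw.2 != [::]}.
    by move=> cw cwt; apply: t0; rewrite inE cwt orbT.
  by rewrite /eval_words !big_cons /= phiD ?phiZ ?phiw ?IH //; exists t.
by rewrite -phiE // -Bs phi0.
Qed.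

(** * From relations to inclusion of loci, over any field *)

Definition mxtens_block (F : fieldType) d n (Z : 'M[F]_(d * n)) (j k : 'I_n) :
    'M[F]_d :=
  \matrix_(a, b) Z (mxtens_index (a, j)) (mxtens_index (b, k)).

(** Fixing the indices of the second tensor factor identifies matrices of size d n with n by n
    matrices over the d by d matrices. *)
Lemma mxtens_blockM (F : fieldType) d n (Z W : 'M[F]_(d * n)) j k :
  mxtens_block (Z *m W) j k =
  \sum_l mxtens_block Z j l *m mxtens_block W l k.
Proof.
apply/matrixP => a b; rewrite summxE !mxE.
rewrite (reindex (@mxtens_index d n)) /=; last first.
  by exists (@mxtens_unindex d n) => p _;
    [exact: mxtens_indexK|exact: mxtens_unindexK].
transitivity (\sum_p \sum_q Z (mxtens_index (a, j)) (mxtens_index (p, q)) *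
    W (mxtens_index (p, q)) (mxtens_index (b, k))).
  by rewrite pair_bigA; apply: eq_bigr => -[].
rewrite exchange_big; apply: eq_bigr => l _; rewrite !mxE.
by apply: eq_bigr => p _; rewrite !mxE.
Qed.

(** Powers as iterated products allow every size, including 0 and d * n. *)
Lemma Cayley_Hamilton_iter (F : fieldType) n (M : 'M[F]_n) :
  \sum_(k < size (char_poly M)) (char_poly M)`_k *: iter k (mulmx M) 1%:M = 0.
Proof.
case: n M => [|n] M; first by rewrite [LHS]thinmx0 [RHS]thinmx0.
rewrite -[RHS](Cayley_Hamilton M) -[X in horner_mx M X]coefK poly_def.
rewrite raddf_sum; apply: eq_bigr => k _ /=.
rewrite linearZ /= rmorphXn /= horner_mx_X; congr (_ *: _).
by elim: (k : nat) => [|m IH] //=; rewrite IH exprS.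
Qed.

Lemma relations_sub_locus (F : fieldType) g d e (A : 'I_g -> 'M[F]_d)
    (B : 'I_g -> 'M[F]_e) :
  relations_sub A B -> forall n (X : 'I_g -> 'M[F]_n),
    \det (pencil_eval A X) = 0 -> \det (pencil_eval B X) = 0.
Proof.
move=> AB n X /det_pencil_eq0 /eigenvalueP[u uA u0]; apply/det_pencil_eq0.
rewrite scale1r in uA; set p := char_poly (kron_sum B X).
pose rel (Z : 'M[F]_(e * n)) (W : 'M[F]_(d * n)) :=
  forall j k, hom_graph A B (mxtens_block Z j k) (mxtens_block W j k).
have relM Z W Z' W' : rel Z W -> rel Z' W' -> rel (Z *m Z') (W *m W').
  by move=> ZW ZW' j k; rewrite !mxtens_blockM; apply: hom_graph_sum => l;
    apply: hom_graphM.
have rel_gen : rel (kron_sum B X) (kron_sum A X).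
  have blockE m (D : 'I_g -> 'M[F]_m) j k :
      mxtens_block (kron_sum D X) j k = \sum_i X i j k *: D i.
    apply/matrixP => a b; rewrite mxE !summxE; apply: eq_bigr => i _.
    by rewrite tensmxE mxE mulrC.
  move=> j k; rewrite !blockE; apply: hom_graph_sum => i.
  exact/hom_graphZ/hom_graph_gen.
have rel_iter k : rel (iter k.+1 (mulmx (kron_sum B X)) 1%:M)
    (iter k.+1 (mulmx (kron_sum A X)) 1%:M).
  elim: k => [|k IH]; first by rewrite /= !mulmx1.
  by rewrite iterS [X in rel _ X]iterS; apply: relM.
(* The exponent [k.+1] encodes 'X * p: without a constant term, each block of [q] stays a
   combination of nonempty words. *)
pose q m (M : 'M[F]_m) := \sum_(k < size p) p`_k *: iter k.+1 (mulmx M) 1%:M.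
have qB : q _ (kron_sum B X) = 0.
  rewrite -[RHS](mulmx0 _ (kron_sum B X)) -(Cayley_Hamilton_iter (kron_sum B X)).
  by rewrite mulmx_sumr; apply: eq_bigr => k _; rewrite -scalemxAr.
have blockS m (Z : 'I_(size p) -> 'M[F]_(m * n)) j k :
    mxtens_block (\sum_(l < size p) p`_l *: Z l) j k =
      \sum_(l < size p) p`_l *: mxtens_block (Z l) j k.
  apply/matrixP => a b; rewrite mxE !summxE; apply: eq_bigr => l _.
  by rewrite !mxE.
have qA : q _ (kron_sum A X) = 0.
  apply/matrixP => a b.
  case: (mxtens_indexP a) => i j; case: (mxtens_indexP b) => k l.
  have /AB/matrixP/(_ i k) : hom_graph A B 0 (mxtens_block (q _ (kron_sum A X)) j l).
    have -> : 0 = mxtens_block (q _ (kron_sum B X)) j l.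
      by rewrite qB; apply/matrixP => ? ?; rewrite !mxE.
    rewrite !blockS; apply: hom_graph_sum => m.
    exact/hom_graphZ/rel_iter.
  by rewrite !mxE.
have u_iter k : u *m iter k (mulmx (kron_sum A X)) 1%:M = u.
  by elim: k => [|k IH] /=; rewrite ?mulmx1 // mulmxA uA.
(* Since [u] is fixed by [kron_sum A X], applying it to q = 0 leaves p(1) u = 0. *)
have := congr1 (mulmx u) qA; rewrite mulmx0 mulmx_sumr.
under eq_bigr do rewrite -scalemxAr u_iter.
rewrite -scaler_suml => /eqP; rewrite scaler_eq0 (negPf u0) orbF => p1.
rewrite eigenvalue_root_char rootE horner_coef -/p.
by under eq_bigr do rewrite expr1n mulr1.
Qed.

(** * From hermitian loci to relations *)

(** If 0 were the only eigenvalue, the polynomial 'X would annihilate the normal matrix [M]. *)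
Lemma hermitian_eigenvalue_neq0 (C : numClosedFieldType) n (M : 'M[C]_n) :
  M \is hermsymmx -> M != 0 -> exists2 a, a != 0 & eigenvalue M a.
Proof.
case: n M => [|n] M Mh M0; first by rewrite thinmx0 eqxx in M0.
apply: contrapT => nex; move/eqP: M0; apply.
rewrite -(horner_mx_X M); apply: normal_horner_eq0 => [|a Ma].
  exact: hermitian_normalmx.
by rewrite rootX; apply/negP => a0; apply: nex; exists a => //; apply/negP.
Qed.

Lemma adjmx_involution (C : numClosedFieldType) :
  @semilinear_involution C Num.conj (fun n => @adjmx C n n).
Proof.
split=> [n M N|n c M|n M N|n].
- by rewrite /adjmx linearD /= map_mxD.
- exact: adjmxZ.
- exact: adjmxM.
- exact: adjmx1.
Qed.

Lemma herm_locus_sub_relations (C : numClosedFieldType) g d e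
    (A : 'I_g -> 'M[C]_d) (B : 'I_g -> 'M[C]_e) :
  (forall i, A i \is hermsymmx) -> (forall i, B i \is hermsymmx) ->
  herm_locus_sub A B -> relations_sub A B.
Proof.
move=> Ah Bh /(herm_locus_sub_full Ah) AB N N_rel; apply: mulmx_adj_eq0.
set H := _ *m _; apply: contrapT => /eqP H0.
(* Eigenvectors are rows here; transposing [H] yields a column eigenvector [u^T] of [H] itself. *)
have [a a0] : exists2 a, a != 0 & eigenvalue H^T a.
  apply: hermitian_eigenvalue_neq0; last first.
    by apply: contra_neq H0 => H0; rewrite -[H]trmxK H0 trmx0.
  have Hh : adjmx H = H by rewrite adjmxM adjmxK.
  by apply/hermsymmxP; rewrite -[in RHS]Hh /adjmx !map_trmx !trmxK.
case/eigenvalueP => u uH u0.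
have [s s0 [Bs As]] : hom_graph A B 0 (a^-1 *: H).
  rewrite -(scaler0 _ a^-1) -(mul0mx _ (adjmx (0 : 'M[C]_e))).
  apply/hom_graphZ/hom_graphM => //.
  by apply: (hom_graph_star (adjmx_involution C) _ _ N_rel) => i; apply/hermsymmxP.
have [n [X XP]] := linearization s0.
have singP m (D : 'I_g -> 'M[C]_m) :
    \det (pencil_eval D (fun i => (X i)^T)) = 0 <->
    exists2 u : 'cV[C]_m, u != 0 & eval_words D s *m u = u.
  rewrite -XP pencil_singularP.
  have E (V : 'M[C]_(m, n)) :
      \sum_i D i *m V *m (X i)^T^T = \sum_i D i *m V *m X i.
    by apply: eq_bigr => i _; rewrite trmxK.
  by split=> -[V V0 VE]; exists V; rewrite ?E // -?E.
(* Rescaled by 1 / a, [H] fixes [u^T], so the pencil of [A] is singular at X^T. The inclusion makes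
   that of [B] singular too, giving a nonzero vector fixed by the zero matrix. *)
have /singP[v v0] : \det (pencil_eval B (fun i => (X i)^T)) = 0.
  apply/AB/singP; exists u^T; first by rewrite trmx_eq0.
  rewrite -As -scalemxAl -[H]trmxK -trmx_mul uH linearZ /= scalerA mulVf //.
  by rewrite scale1r.
by rewrite -Bs mul0mx => /esym/eqP; rewrite (negPf v0).
Qed.

(** * Reduction of the symmetric case to the hermitian one *)

Definition complexify (R : realType) m n (M : 'M[R]_(m, n)) : 'M[R[i]]_(m, n) :=
  map_mx (real_complex R) M.

Definition re_im_mx (R : realType) m n (P Q : 'M[R]_(m, n)) : 'M[R[i]]_(m, n) :=
  complexify P + 'i *: complexify Q.

Lemma re_im_mxE (R : realType) m n (P Q : 'M[R]_(m, n)) i j :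
  re_im_mx P Q i j = (P i j +i* Q i j)%C.
Proof.
by rewrite !mxE [RHS]complexE.
Qed.

Lemma re_im_mxP (R : realType) m n (M : 'M[R[i]]_(m, n)) :
  exists P Q, M = re_im_mx P Q.
Proof.
exists (map_mx (@complex.Re R) M), (map_mx (@complex.Im R) M).
by apply/matrixP => i j; rewrite re_im_mxE !mxE; case: (M i j).
Qed.

Lemma re_im_mx_inj (R : realType) m n (P Q P' Q' : 'M[R]_(m, n)) :
  re_im_mx P Q = re_im_mx P' Q' -> P = P' /\ Q = Q'.
Proof.
move=> /matrixP E; split; apply/matrixP => i j; have := E i j;
  by rewrite !re_im_mxE => -[].
Qed.

Lemma re_im_mx_tr (R : realType) m n (P Q : 'M[R]_(m, n)) :
  (re_im_mx P Q)^T = re_im_mx P^T Q^T.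
Proof. by apply/matrixP => i j; rewrite mxE !re_im_mxE !mxE. Qed.

Lemma re_im_mx_sum (R : realType) m n (I : Type) (r : seq I)
    (P Q : I -> 'M[R]_(m, n)) :
  \sum_(i <- r) re_im_mx (P i) (Q i) =
  re_im_mx (\sum_(i <- r) P i) (\sum_(i <- r) Q i).
Proof. by rewrite big_split -scaler_sumr /re_im_mx /complexify !raddf_sum. Qed.

Lemma row_mx_sum (V : nmodType) m n1 n2 (I : Type) (r : seq I)
    (P : I -> 'M[V]_(m, n1)) (Q : I -> 'M[V]_(m, n2)) :
  \sum_(i <- r) row_mx (P i) (Q i) =
  row_mx (\sum_(i <- r) P i) (\sum_(i <- r) Q i).
Proof.
elim/big_rec3: _ => [|i x y z _ ->]; first by rewrite row_mx0.
by rewrite add_row_mx.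
Qed.

Lemma re_im_mxM (R : realType) m n p (M : 'M[R]_m) (a b : 'M[R]_(m, n))
    (P Q : 'M[R]_(n, p)) :
  complexify M *m re_im_mx a b *m re_im_mx P Q =
  re_im_mx (M *m (a *m P - b *m Q)) (M *m (a *m Q + b *m P)).
Proof.
rewrite -mulmxA /re_im_mx /complexify !map_mxM scalemxAr -mulmxDr; congr (_ *m _).
rewrite map_mxB map_mxD !map_mxM mulmxDl !mulmxDr -!scalemxAl -!scalemxAr.
rewrite scalerA -expr2 sqrCi scaleN1r scalerDr.
by rewrite [X in _ + X = _]addrC addrACA.
Qed.

Definition real_block (R : realType) n (P Q : 'M[R]_n) : 'M[R]_(n + n) :=
  block_mx P (- Q) Q P.

(* The identification of [a + i b] with the real row block [a b] turns
   multiplication by [(P + i Q)^T] into multiplication by [(real_block P Q)^T]. *)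
Lemma det_pencil_real_block (R : realType) g d n (A : 'I_g -> 'M[R]_d)
    (P Q : 'I_g -> 'M[R]_n) :
  \det (pencil_eval (fun i => complexify (A i)) (fun i => re_im_mx (P i) (Q i))) = 0
  <-> \det (pencil_eval A (fun i => real_block (P i) (Q i))) = 0.
Proof.
rewrite !pencil_singularP.
have E (a b : 'M[R]_(d, n)) :
  \sum_i complexify (A i) *m re_im_mx a b *m (re_im_mx (P i) (Q i))^T =
    re_im_mx a b <->
  \sum_i A i *m row_mx a b *m (real_block (P i) (Q i))^T = row_mx a b.
  have -> : \sum_i complexify (A i) *m re_im_mx a b *m (re_im_mx (P i) (Q i))^T =
      re_im_mx (\sum_i A i *m (a *m (P i)^T - b *m (Q i)^T))
        (\sum_i A i *m (a *m (Q i)^T + b *m (P i)^T)).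
    rewrite -re_im_mx_sum; apply: eq_bigr => i _.
    by rewrite re_im_mx_tr re_im_mxM.
  have -> : \sum_i A i *m row_mx a b *m (real_block (P i) (Q i))^T =
      row_mx (\sum_i A i *m (a *m (P i)^T - b *m (Q i)^T))
        (\sum_i A i *m (a *m (Q i)^T + b *m (P i)^T)).
    rewrite -row_mx_sum; apply: eq_bigr => i _.
    rewrite -mulmxA -mul_mx_row /real_block tr_block_mx mul_row_block.
    by rewrite linearN /= mulmxN.
  by split=> [/re_im_mx_inj[-> ->]|/eq_row_mx[-> ->]].
split=> [[V]|[V]].
  have [a [b ->]] := re_im_mxP V => V0 /E VE; exists (row_mx a b) => //.
  apply: contra_neq V0; rewrite -row_mx0 => /eq_row_mx[-> ->].
  by rewrite /re_im_mx /complexify map_mx0 scaler0 addr0.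
rewrite -[V]hsubmxK => V0 /E VE; exists (re_im_mx (lsubmx V) (rsubmx V)) => //.
apply: contra_neq V0 => V0.
have /re_im_mx_inj[-> ->] : re_im_mx (lsubmx V) (rsubmx V) = re_im_mx 0 0.
  by rewrite V0 /re_im_mx /complexify map_mx0 scaler0 addr0.
exact: row_mx0.
Qed.

Lemma conj_real_complex (R : realType) (x : R) :
  Num.conj (x%:C)%C = (x%:C)%C.
Proof. by apply: conj_Creal; rewrite complex_real. Qed.

Lemma symmetricmxP (R : realType) n (M : 'M[R]_n) :
  M \is symmetricmx <-> M^T = M.
Proof.
rewrite qualifE /= expr0 scale1r map_mx_id //.
by split=> [/eqP/esym|/esym/eqP].
Qed.

Lemma complexify_hermitian (R : realType) n (M : 'M[R]_n) :
  M \is symmetricmx -> complexify M \is hermsymmx.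
Proof.
move=> /symmetricmxP Ms; apply/hermsymmxP/matrixP => i j.
by rewrite -[in RHS]Ms !mxE conj_real_complex.
Qed.

Lemma real_block_symmetric (R : realType) n (P Q : 'M[R]_n) :
  re_im_mx P Q \is hermsymmx -> real_block P Q \is symmetricmx.
Proof.
move=> /hermsymmxP; rewrite /adjmx re_im_mx_tr => h.
(* P + i Q is hermitian exactly when [P] is symmetric and [Q] antisymmetric, which makes the real
   block symmetric. *)
have /re_im_mx_inj[PE QE] : re_im_mx P^T (- Q^T) = re_im_mx P Q.
  rewrite -[RHS]h; apply/matrixP => i j.
  rewrite [RHS]mxE !mxE rmorphD rmorphM /= !conj_real_complex conjCi.
  by rewrite rmorphN /= mulrN mulNr.
apply/symmetricmxP; rewrite /real_block tr_block_mx linearN /= -QE PE.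
by rewrite linearN /= trmxK opprK QE.
Qed.

(** A real relation is a complex one with real coefficients, and complexification is injective. *)
Lemma complexify_relations (R : realType) g d e (A : 'I_g -> 'M[R]_d)
    (B : 'I_g -> 'M[R]_e) :
  relations_sub (fun i => complexify (A i)) (fun i => complexify (B i)) ->
  relations_sub A B.
Proof.
move=> AB N [s s0 [Bs As]].
have E n (D : 'I_g -> 'M[R]_n) : complexify (eval_words D s) =
    eval_words (fun i => complexify (D i)) [seq ((cw.1)%:C%C, cw.2) | cw <- s].
  rewrite /eval_words big_map /complexify raddf_sum; apply: eq_bigr => -[c w] _ /=.
  rewrite map_mxZ; congr (_ *: _); elim: w => [|i w IH].
    by rewrite !word_mx_nil map_mx1.
  by rewrite !word_mx_cons map_mxM IH.
apply: (map_mx_inj (f := real_complex R)).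
rewrite map_mx0 As; apply: AB.
exists [seq ((cw.1)%:C%C, cw.2) | cw <- s].
  by move=> _ /mapP[cw /s0 cw0 ->].
by rewrite -!E -Bs /complexify map_mx0.
Qed.

(** * Both cases assembled: locus inclusion, relations, homomorphism *)

Lemma trmx_involution (R : realType) :
  semilinear_involution idfun (@transpose R).
Proof.
split=> [n M N|n c M|n M N|n]; rewrite /transpose.
- exact: linearD.
- exact: linearZ.
- exact: trmx_mul.
- exact: trmx1.
Qed.

Lemma symmetric_relations (R : realType) g d e (A : 'I_g -> 'M[R]_d)
    (B : 'I_g -> 'M[R]_e) :
  (forall i, A i \is symmetricmx) -> (forall i, B i \is symmetricmx) ->
  free_locus_s A `<=` free_locus_s B <-> relations_sub A B.
Proof.
move=> As Bs; split=> [AB|AB [n X] [Xs XA]]; last first.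
  by split=> //; apply: relations_sub_locus AB _ _ XA.
apply/complexify_relations/herm_locus_sub_relations => [i|i|n X Xh].
- exact: complexify_hermitian.
- exact: complexify_hermitian.
have /choice[P /choice[Q XE]] i := re_im_mxP (X i).
have -> : X = fun i => re_im_mx (P i) (Q i) by apply/funext.
move=> /det_pencil_real_block AX; apply/det_pencil_real_block.
have [] // := AB (existT _ (n + n)%N (fun i => real_block (P i) (Q i))).
by split=> //= i; apply: real_block_symmetric; rewrite -XE.
Qed.

Lemma hermitian_relations (R : realType) g d e (A : 'I_g -> 'M[R[i]]_d)
    (B : 'I_g -> 'M[R[i]]_e) :
  (forall i, A i \is hermsymmx) -> (forall i, B i \is hermsymmx) ->
  free_locus_h A `<=` free_locus_h B <-> relations_sub A B.
Proof.
move=> Ah Bh; split=> [AB|AB [n X] [Xh XA]]; last first.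
  by split=> //; apply: relations_sub_locus AB _ _ XA.
apply: herm_locus_sub_relations => // n X Xh XA.
by have [] := AB (existT _ n X) (conj Xh XA).
Qed.

Theorem theorem5p4 (R : realType) (g d e : nat) :
  (forall (A : 'I_g -> 'M[R]_d) (B : 'I_g -> 'M[R]_e),
     (forall i, A i \is symmetricmx) -> (forall i, B i \is symmetricmx) ->
     (free_locus_s A `<=` free_locus_s B <->
      exists phi : 'M[R]_e -> 'M[R]_d,
        star_hom (@transpose R) (gen_alg B) (gen_alg A) phi
        /\ (forall i, phi (B i) = A i)))
  /\
  (forall (A : 'I_g -> 'M[R[i]]_d) (B : 'I_g -> 'M[R[i]]_e),
     (forall i, A i \is hermsymmx) -> (forall i, B i \is hermsymmx) ->
     (free_locus_h A `<=` free_locus_h B <->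
      exists phi : 'M[R[i]]_e -> 'M[R[i]]_d,
        star_hom (@conj_transpose R) (gen_alg B) (gen_alg A) phi
        /\ (forall i, phi (B i) = A i))).
Proof.
split=> A B As Bs.
  rewrite (symmetric_relations As Bs).
  by apply: (star_hom_exists (trmx_involution R)) => i; apply/symmetricmxP.
rewrite (hermitian_relations As Bs).
by apply: (star_hom_exists (adjmx_involution R[i])) => i; apply/hermsymmxP.
Qed.
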